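(* Let $Q$ be an involutory quandle such that $|L_aL_b|$ is finite for every $a,b\in Q$. The following are equivalent: (i) $Q$ is superfaithful. (ii) $Q$ is latin. (iii) For every $a,b\in Q$, $\mathrm{ord}_{a,b}=|L_aL_b|$ and this number is odd.
   Context: A quandle is an algebra $(Q,*,\backslash)$ satisfying $x\backslash(x*y)=y=x*(x\backslash y)$ (so every left multiplication $L_a:b\mapsto a*b$ is a bijection), $x*(y*z)=(x*y)*(x*z)$ and $x*x=x$. It is involutory if $x*(x*y)=y$, and latin if every right multiplication $R_a:b\mapsto b*a$ is also a bijection of $Q$. $Q$ may be infinite. $Q$ is faithful if $L_a=L_b$ implies $a=b$, and superfaithful if every subalgebra (subset closed under $*$ and $\backslash$) is faithful as a quandle in its own right. $|L_aL_b|$ denotes the order of the permutation $L_aL_b$ of $Q$. For $a,b\in Q$ and $k\in\mathbb Z$ put $a^k=(L_aL_b)^i(b)$ if $k=2i$ and $a^k=(L_aL_b)^i(a)$ if $k=2i+1$ (so $a^0=b$, $a^1=a$). Then $\mathrm{ord}_{a,b}=\min\{k>0: a^k=b\}$. *)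

(* Defs.v *)
From HB Require Import structures.
From mathcomp Require Import all_boot all_order all_algebra.
From Stdlib Require ProofIrrelevance.

Set Implicit Arguments.
Unset Strict Implicit.
Unset Printing Implicit Defensive.

Declare Scope quandle_scope.
Delimit Scope quandle_scope with quandle.
Local Open Scope quandle_scope.

HB.mixin Record isQuandle (Q : Type) := {
  qmul : Q -> Q -> Q;
  qldiv : Q -> Q -> Q;
  qmulK : forall x y, qldiv x (qmul x y) = y;
  qldivK : forall x y, qmul x (qldiv x y) = y;
  qmulDl : forall x y z, qmul x (qmul y z) = qmul (qmul x y) (qmul x z);
  qmulxx : forall x, qmul x x = x
}.

#[short(type="quandleType")]
HB.structure Definition Quandle := { Q of isQuandle Q }.

Notation "x * y" := (qmul x y) : quandle_scope.
Notation "x \\ y" := (qldiv x y)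
  (at level 40, left associativity) : quandle_scope.

Definition L (Q : quandleType) (a : Q) : Q -> Q := fun b => a * b.
Definition R (Q : quandleType) (a : Q) : Q -> Q := fun b => b * a.

Definition involutory (Q : quandleType) : Prop :=
  forall x y : Q, x * (x * y) = y.

(* Left multiplications are bijective by the quandle axioms. *)
Definition latin (Q : quandleType) : Prop := forall a : Q, bijective (R a).

Definition faithful (Q : quandleType) : Prop :=
  forall a b : Q, L a =1 L b -> a = b.

Record subalgebra (Q : quandleType) := Subalgebra {
  in_subalg :> Q -> Prop;
  subalg_mul : forall x y, in_subalg x -> in_subalg y -> in_subalg (x * y);
  subalg_ldiv : forall x y, in_subalg x -> in_subalg y -> in_subalg (x \\ y)
}.

Definition subquandle (Q : quandleType) (S : subalgebra Q) : Type :=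
  {x : Q | S x}.

Section Subquandle.
Variables (Q : quandleType) (S : subalgebra Q).
Implicit Types x y z : subquandle S.

Lemma subquandle_inj x y : sval x = sval y -> x = y.
Proof.
case: x y => [x Sx] [y Sy] /= exy; case: y / exy Sy => Sy.
by rewrite (ProofIrrelevance.proof_irrelevance _ Sx Sy).
Qed.

Definition sub_mul x y : subquandle S :=
  exist _ (sval x * sval y) (subalg_mul (svalP x) (svalP y)).

Definition sub_ldiv x y : subquandle S :=
  exist _ (sval x \\ sval y) (subalg_ldiv (svalP x) (svalP y)).

Lemma sub_mulK x y : sub_ldiv x (sub_mul x y) = y.
Proof. by apply: subquandle_inj; rewrite /= qmulK. Qed.

Lemma sub_ldivK x y : sub_mul x (sub_ldiv x y) = y.
Proof. by apply: subquandle_inj; rewrite /= qldivK. Qed.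

Lemma sub_mulDl x y z :
  sub_mul x (sub_mul y z) = sub_mul (sub_mul x y) (sub_mul x z).
Proof. by apply: subquandle_inj; rewrite /= qmulDl. Qed.

Lemma sub_mulxx x : sub_mul x x = x.
Proof. by apply: subquandle_inj; rewrite /= qmulxx. Qed.

HB.instance Definition _ := isQuandle.Build (subquandle S)
  sub_mulK sub_ldivK sub_mulDl sub_mulxx.

End Subquandle.

Definition superfaithful (Q : quandleType) : Prop :=
  forall S : subalgebra Q, faithful (subquandle S).

Definition least_pos (P : nat -> Prop) (n : nat) : Prop :=
  [/\ (0 < n)%N, P n & forall m, (0 < m)%N -> P m -> (n <= m)%N].

(* The order of f is a relation between f and n, since it may be infinite;
   when f is a permutation, f has finite order iff it is related to some n. *)
Definition has_order (T : Type) (f : T -> T) (n : nat) : Prop :=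
  least_pos (fun k => iter k f =1 id) n.

(* The power (L_a L_b)^i for i : int; note that Negz n stands for - n.+1. *)
Definition LLpow (Q : quandleType) (a b : Q) (i : int) : Q -> Q :=
  match i with
  | Posz n => iter n (L a \o L b)
  | Negz n => iter n.+1 (fun x => b \\ (a \\ x))
  end.

(* The element written a^k, which depends on b as well; the division is the
   Euclidean one, so that k = 2 (k %/ 2) + (k %% 2) with k %% 2 in {0, 1}. *)
Definition qpow (Q : quandleType) (a b : Q) (k : int) : Q :=
  LLpow a b (k %/ 2)%Z (if (k %% 2)%Z == 0 then b else a).

Lemma qpow_even (Q : quandleType) (a b : Q) (i : int) :
  qpow a b (2 * i)%R = LLpow a b i b.
Proof. by rewrite /qpow GRing.mulrC mulzK // modzMl. Qed.

Lemma qpow_odd (Q : quandleType) (a b : Q) (i : int) :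
  qpow a b (2 * i + 1)%R = LLpow a b i a.
Proof. by rewrite /qpow GRing.mulrC divzMDl // modzMDl GRing.addr0. Qed.

Definition has_ord (Q : quandleType) (a b : Q) (n : nat) : Prop :=
  least_pos (fun k => qpow a b k%:Z = b) n.

(* Main.v *)
Require Import Defs.
From mathcomp Require Import all_boot.
From mathcomp Require Import ssrint.
From Stdlib Require IndefiniteDescription.

(** Write t = L_a L_b. In an involutory quandle L_(x * y) = L_x L_y L_x, and
    conjugating t by L_b inverts it; hence L_(a^k) = t^k L_b
    ([lmul_qpow]). The points a^k thus behave like the reflections of a
    dihedral group, and a^k = b forces t^k = 1. The three conditions are proved
    equivalent in a cycle.

    - Superfaithful implies the condition on orders ([superfaithful_ord]). If t
      has order n, then a^n and b have the same left multiplication, so a^n = b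
      by faithfulness, and n is the least such exponent by the above. If
      n = 2m, then c = a^m satisfies c * b = b, and b * c = c because b * c and
      c have the same left multiplication. So {b, c} is a subquandle with
      trivial multiplication, hence b = c, against the minimality of n.

    - The condition on orders implies latin ([ord_latin]). For odd n, halving
      exponents modulo n solves x * u = v: the point x = v^((n+1)/2) relative
      to u has x * u = v^(n+1) = v ([rmul_surj]). If x * u = y * u, then L_x L_u
      and L_y L_u have the same square; both have odd order, so they are equal
      and L_x = L_y. Then L_x L_y has order 1, so x = x^1 = y
      ([rmul_inj]).

    - Latin implies superfaithful ([latin_superfaithful]): if L_x = L_y on a
      subquandle containing x and y, then x * x = y * x, and x cancels on the
      right. *)

Set Implicit Arguments.
Unset Strict Implicit.
Unset Printing Implicit Defensive.

Local Open Scope quandle_scope.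

Lemma iter_mul_id T (f : T -> T) n k : iter n f =1 id -> iter (k * n)%N f =1 id.
Proof. by move=> fn z; elim: k => [|k IHk] //; rewrite mulSn iterD IHk fn. Qed.

(** If f^N = 1 with N odd, then f = (f^2)^((N+1)/2), and N can be chosen
    common to f and g. *)
Lemma eq_sqr_odd_order T (f g : T -> T) m n : odd m -> odd n ->
  iter m f =1 id -> iter n g =1 id -> f \o f =1 g \o g -> f =1 g.
Proof.
move=> m_odd n_odd fm gn ffgg.
have iterfg k z : iter k.*2 f z = iter k.*2 g z.
  by elim: k => //= k ->; apply: ffgg.
have N_even : (m * n).+1./2.*2 = (m * n).+1.
  by rewrite even_halfK //= oddM m_odd n_odd.
move=> z; have := iterfg (m * n).+1./2 z.
by rewrite N_even !iterS [in iter _ f]mulnC !iter_mul_id.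
Qed.

Section Involutory.

Variable Q : quandleType.
Hypothesis Qinvol : involutory Q.
Implicit Types (a b x y z u v : Q) (k m n : nat).

Lemma ldivE x y : x \\ y = x * y.
Proof. by rewrite -{1}(Qinvol x y) qmulK. Qed.

Lemma lmul_mul x y z : (x * y) * z = x * (y * (x * z)).
Proof. by rewrite (qmulDl x y) Qinvol. Qed.

Lemma qpow_nat a b k :
  qpow a b (Posz k) = iter k./2 (L a \o L b) (if odd k then a else b).
Proof.
rewrite -[in LHS](odd_double_half k) addnC -mul2n PoszD PoszM.
by case: (odd k); rewrite ?qpow_odd // ssralg.GRing.addr0 qpow_even.
Qed.

Lemma qpowSS a b k :
  qpow a b (Posz k.+2) = a * (b * qpow a b (Posz k)).
Proof. by rewrite !qpow_nat /= negbK. Qed.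

(** Induction in steps of two: with t = L_a L_b, passing from a^k to a^(k+2)
    conjugates L_(a^k) by t, and t (t^k L_b) t^-1 = t^(k+2) L_b because L_b
    inverts t. *)
Lemma lmul_qpow a b k z :
  qpow a b (Posz k) * z = iter k (L a \o L b) (b * z).
Proof.
elim/ltn_ind: k z => -[|[|k]] IHk z; try by rewrite qpow_nat /L /= ?Qinvol.
by rewrite qpowSS !lmul_mul IHk // Qinvol iterS iterSr /L /= Qinvol.
Qed.

(** Conjugation by L_b inverts L_a L_b, hence also its powers. *)
Lemma iter_lmul_iter a b k z :
  iter k (L a \o L b) (b * iter k (L a \o L b) z) = b * z.
Proof. by elim: k z => // k IHk z; rewrite iterSr iterS /L /= !Qinvol IHk. Qed.

Lemma qpow_fix_iter a b k :
  qpow a b (Posz k) = b -> iter k (L a \o L b) =1 id.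
Proof. by move=> akb z; rewrite -(Qinvol b z) -lmul_qpow akb. Qed.

Lemma has_order_ord a b n :
  has_order (L a \o L b) n -> qpow a b (Posz n) = b -> has_ord a b n.
Proof.
case=> n_gt0 _ n_min anb; split=> // m m_gt0 amb.
exact/n_min/qpow_fix_iter.
Qed.

Lemma superfaithful_faithful : superfaithful Q -> faithful Q.
Proof.
move=> Qsf a b Lab.
pose S := @Subalgebra Q (fun=> True) (fun _ _ _ _ => I) (fun _ _ _ _ => I).
have : (exist _ a I : subquandle S) = exist _ b I.
  by apply: Qsf => z; apply: subquandle_inj; apply: Lab.
by case.
Qed.

(** Idempotency makes {x, y} a subquandle whose left multiplications are all
    the identity, so faithfulness collapses it. *)
Lemma superfaithful_fix x y : superfaithful Q -> x * y = y -> y * x = x -> x = y.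
Proof.
move=> Qsf xy yx; pose P z := z = x \/ z = y.
have Pmul z w : P z -> P w -> z * w = w.
  by move=> [] -> [] ->; rewrite ?qmulxx.
have Pm z w : P z -> P w -> P (z * w) by move=> Pz Pw; rewrite Pmul.
have Pd z w : P z -> P w -> P (z \\ w) by move=> Pz Pw; rewrite ldivE Pmul.
pose S := Subalgebra Pm Pd.
have Sx : S x by left.
have Sy : S y by right.
have : (exist _ x Sx : subquandle S) = exist _ y Sy.
  by apply: Qsf => -[z Sz]; apply: subquandle_inj; rewrite /= !Pmul.
by case.
Qed.

(** An even order n = 2m would give the pair b, a^m trivial multiplication,
    since a^(2m) = b and L_b commutes with the involution (L_a L_b)^m. *)
Lemma superfaithful_ord a b n : superfaithful Q ->
  has_order (L a \o L b) n -> has_ord a b n /\ odd n.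
Proof.
move=> Qsf ordn; have Qf := superfaithful_faithful Qsf.
have [n_gt0 tn _] := ordn.
have anb : qpow a b (Posz n) = b.
  by apply: Qf => z; rewrite /L lmul_qpow tn.
have ord_n := has_order_ord ordn anb; split=> //.
apply/negPn/negP => n_even.
have := odd_double_half n; rewrite (negbTE n_even) add0n.
set m := n./2 => nE; rewrite -nE in n_gt0.
have m_gt0 : (0 < m)%N by rewrite -double_gt0.
pose c := qpow a b (Posz m).
have cb : c * b = b.
  by rewrite lmul_qpow qmulxx -[RHS]anb qpow_nat (negbTE n_even).
(* L_(b * c) = L_b t^m, and t^m commutes with L_b because t^(2m) = 1. *)
have bc : b * c = c.
  apply: Qf => z; rewrite /L lmul_mul !lmul_qpow Qinvol.
  by rewrite -[RHS](congr1 _ (iter_lmul_iter a b m z)) -iterD addnn nE tn.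
have := superfaithful_fix Qsf bc cb => bE.
have [_ _ /(_ m m_gt0 (esym bE))] := ord_n.
by rewrite -nE -addnn -{3}[m]addn0 leq_add2l leqNgt m_gt0.
Qed.

Lemma latin_superfaithful : latin Q -> superfaithful Q.
Proof.
move=> Ql S x y /(_ x) /(congr1 sval); rewrite /L /= => xy.
exact/subquandle_inj/(bij_inj (Ql (sval x))).
Qed.

(** With k = (n+1)/2, the point v^k relative to u multiplies u to v^(2k), which
    is v^(n+1); as n is odd, u = v^n is t^((n-1)/2) v for t = L_v L_u, so
    v^(n+1) = t^k u = t^n v. *)
Lemma rmul_surj u v n : iter n (L v \o L u) =1 id ->
  qpow v u (Posz n) = u -> odd n -> exists x, x * u = v.
Proof.
move=> tn vnu n_odd; exists (qpow v u (Posz n.+1./2)).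
have nE : (n.+1./2 + n./2)%N = n.
  by rewrite -uphalfE uphalf_half n_odd -addnA addnn -[RHS]odd_double_half n_odd.
by rewrite lmul_qpow qmulxx -{2}vnu qpow_nat n_odd -iterD nE tn.
Qed.

Hypothesis Qord : forall a b, exists n,
  [/\ has_ord a b n, has_order (L a \o L b) n & odd n].

(** If v = x * u, then (L_x L_u)^2 = L_v L_u depends only on v and u; odd order
    recovers L_x L_u, hence L_x. The equality on orders for the pair (x, y) is
    then what turns L_x = L_y into x = y. *)
Lemma rmul_inj u : injective (R u).
Proof.
move=> x y; rewrite /R => xyu.
have [m [_ [_ fm _] m_odd]] := Qord x u.
have [n [_ [_ gn _] n_odd]] := Qord y u.
have Lxy z : x * z = y * z.
  (* As u * (u * z) = z, it suffices to show L_x L_u = L_y L_u. *)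
  rewrite -(Qinvol u z); apply: (eq_sqr_odd_order m_odd n_odd fm gn) => w.
  by rewrite /L /= -!lmul_mul xyu.
have [k [[k_gt0 xky _] [_ _ k_min] _]] := Qord x y.
have k1 : k = 1%N.
  by apply/eqP; rewrite eqn_leq k_gt0 k_min // => z; rewrite /L /= Lxy Qinvol.
by move: xky; rewrite k1 qpow_nat.
Qed.

Lemma ord_latin : latin Q.
Proof.
move=> u.
have surj v : exists x, x * u = v.
  have [n [[_ vnu _] [_ tn _] n_odd]] := Qord v u.
  exact: rmul_surj tn vnu n_odd.
have [g gK] := IndefiniteDescription.functional_choice _ surj.
by exists g => [x|]; [apply: (@rmul_inj u); apply: gK | apply: gK].
Qed.

End Involutory.

Theorem corollary3p8 (Q : quandleType)
    (Qinvol : involutory Q)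
    (Qfin : forall a b : Q, exists n : nat, has_order (L a \o L b) n) :
  (superfaithful Q <-> latin Q) /\
  (latin Q <->
   forall a b : Q, exists n : nat,
     [/\ has_ord a b n, has_order (L a \o L b) n & odd n]).
Proof.
have sf_ord : superfaithful Q -> forall a b : Q, exists n : nat,
    [/\ has_ord a b n, has_order (L a \o L b) n & odd n].
  move=> Qsf a b; have [n ordn] := Qfin a b; exists n.
  by have [] := superfaithful_ord Qinvol Qsf ordn.
have ord_l := ord_latin Qinvol.
have l_sf := @latin_superfaithful Q.
by split; split; auto.
Qed.
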